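(* Let $X$ be a compact metrizable space such that $O_X$ is dense in $X$, and let $C_X=X\setminus O_X$. Then $\tau_{k|C_X}$ is the minimum Hausdorff topological group topology on $H(X)$.
   Context: $H(X)$ denotes the group of all homeomorphisms of $X$ onto itself under composition. A topology on a group is a (topological) group topology if the group operations are continuous for it. The minimum Hausdorff group topology on a group $G$ is a Hausdorff group topology on $G$ contained in every Hausdorff group topology on $G$. $O_X=\{x\in X: x \text{ has a neighborhood homeomorphic to } (0,1)\}$ is the one-manifold part of $X$, and $C_X=X\setminus O_X$. For a closed set $C\subseteq X$, a compatible metric $d$ on $X$ and $\epsilon>0$, let $C_\epsilon=\{x\in X: d(x,C)<\epsilon\}$ (with $C_\epsilon=\emptyset$ if $C=\emptyset$), and $$B_\epsilon^{\tau_{k|C}}=\{h\in H(X): d(h(x),x)<\epsilon \text{ and } d(h^{-1}(x),x)<\epsilon \text{ for all } x\in X\setminus C_\epsilon\}.$$ $\tau_{k|C}$ is the collection of all unions of translates $gB_\epsilon^{\tau_{k|C}}$ ($g\in H(X)$, $\epsilon>0$). It does not depend on the choice of compatible metric $d$. *)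

(* Defs.v *)
From HB Require Import structures.
From mathcomp Require Import all_boot all_order all_algebra.
From mathcomp Require Import all_classical all_reals all_analysis.

Set Implicit Arguments.
Unset Strict Implicit.
Unset Printing Implicit Defensive.

Import Order.TTheory GRing.Theory Num.Theory.
Import numFieldNormedType.Exports.

Local Open Scope classical_set_scope.
Local Open Scope ring_scope.

(* The inverse map is a field, but it is determined by the map itself, so two
   homeomorphisms are equal as soon as they agree pointwise (homeo_ext). *)
Record homeo (X : topologicalType) := Homeo {
  homeo_fun :> X -> X;
  homeo_inv : X -> X;
  homeoK : cancel homeo_fun homeo_inv;
  homeoVK : cancel homeo_inv homeo_fun;
  homeo_continuous : continuous homeo_fun;
  homeoV_continuous : continuous homeo_inv
}.

Section HomeoGroup.
Variable X : topologicalType.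
Implicit Types f g h : homeo X.

Lemma homeo_ext f g : f =1 g -> f = g.
Proof.
move=> /funext; case: f g => [f fV fK fVK cf cfV] [g gV gK gVK cg cgV] /= E.
case: _ / E in gK gVK cg *.
have E : fV = gV by apply/funext => x; rewrite -[in LHS](gVK x) fK.
case: _ / E in gK gVK cgV *.
by congr Homeo; exact: Prop_irrelevance.
Qed.

Definition homeo1 : homeo X :=
  Homeo (fun=> erefl) (fun=> erefl) (fun=> cvg_id) (fun=> cvg_id).

Definition homeoV f : homeo X :=
  Homeo (@homeoVK _ f) (@homeoK _ f)
    (@homeoV_continuous _ f) (@homeo_continuous _ f).

Lemma homeoM_continuous f g : continuous (f \o g).
Proof.
by move=> x; apply: continuous_comp; exact: homeo_continuous.
Qed.

Lemma homeoMV_continuous f g : continuous (homeo_inv g \o homeo_inv f).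
Proof.
by move=> x; apply: continuous_comp; exact: homeoV_continuous.
Qed.

Definition homeoM f g : homeo X :=
  Homeo (can_comp (@homeoK _ f) (@homeoK _ g))
    (can_comp (@homeoVK _ g) (@homeoVK _ f))
    (@homeoM_continuous f g) (@homeoMV_continuous f g).

Lemma homeoMA : associative homeoM.
Proof. by move=> f g h; exact: homeo_ext. Qed.

Lemma homeo1M : left_id homeo1 homeoM.
Proof. by move=> f; exact: homeo_ext. Qed.

Lemma homeoM1 : right_id homeo1 homeoM.
Proof. by move=> f; exact: homeo_ext. Qed.

Lemma homeoVM : left_inverse homeo1 homeoV homeoM.
Proof. by move=> f; apply: homeo_ext; exact: homeoK. Qed.

Lemma homeoMV : right_inverse homeo1 homeoV homeoM.
Proof. by move=> f; apply: homeo_ext; exact: homeoVK. Qed.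

HB.instance Definition _ := gen_eqMixin (homeo X).
HB.instance Definition _ := gen_choiceMixin (homeo X).
HB.instance Definition _ :=
  isGroup.Build (homeo X) homeoMA homeo1M homeoM1 homeoVM homeoMV.

End HomeoGroup.

Record is_topology (T : Type) (tau : set_system T) : Prop := IsTopology {
  topologyT : tau setT;
  topologyI : setI_closed tau;
  topology_bigU : forall (I : Type) (F : I -> set T),
    (forall i, tau (F i)) -> tau (\bigcup_i F i)
}.

(* The type T, seen as a topological space with open sets tau. *)
Definition topologized (T : Type) (tau : set_system T)
  (top : is_topology tau) : Type := T.

HB.instance Definition _ (T : choiceType) (tau : set_system T)
  (top : is_topology tau) := Choice.copy (topologized top) T.
HB.instance Definition _ (T : choiceType) (tau : set_system T)
  (top : is_topology tau) :=
  isOpenTopological.Build (topologized top)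
    (topologyT top) (topologyI top) (@topology_bigU _ _ top).

Definition hausdorff_group_topology (G : groupType) (tau : set_system G) : Prop :=
  exists top : is_topology tau,
    [/\ continuous (fun p : topologized top * topologized top =>
          ((p.1 : G) * (p.2 : G))%g : topologized top),
        continuous (fun x : topologized top =>
          ((x : G)^-1)%g : topologized top) &
        hausdorff_space (topologized top)].

Definition minimum_hausdorff_group_topology (G : groupType)
    (tau : set_system G) : Prop :=
  hausdorff_group_topology tau /\
  (forall sigma : set_system G, hausdorff_group_topology sigma ->
     tau `<=` sigma).

Definition homeomorphic (X Y : topologicalType) : Prop :=
  exists (f : X -> Y) (g : Y -> X),
    [/\ cancel f g, cancel g f, continuous f & continuous g].

Definition one_manifold_part (R : realType) (X : topologicalType) : set X :=
  [set x | exists2 N : set X, nbhs x N &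
     homeomorphic (set_type N) (set_type ([set` `]0, 1[] : set R))].
Arguments one_manifold_part : clear implicits.

Section Tau.
Variables (R : realType) (X : metricType R).
Implicit Types (C : set X) (e : R).

(* The distance to C is taken in the extended reals, so that it is +oo, and the
   neighborhood is empty, when C is empty. *)
Definition eps_nbhd C e : set X :=
  [set x | (ereal_inf [set (mdist x c)%:E | c in C] < e%:E)%E].

Definition tau_k_ball C e : set (homeo X) :=
  [set h : homeo X | forall x, (~` eps_nbhd C e) x ->
     mdist (h x) x < e /\ mdist ((h^-1)%g x) x < e].

Definition tau_k C : set_system (homeo X) :=
  [set U | exists2 F : set (homeo X * R),
     (forall p, F p -> 0 < p.2) &
     U = \bigcup_(p in F) [set (p.1 * h)%g | h in tau_k_ball C p.2]].

End Tau.

(* Main.v *)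
Require Import Defs.
From mathcomp Require Import all_boot all_order all_algebra.
From mathcomp Require Import lra.
From mathcomp Require Import all_classical all_reals all_analysis.

(** Write O for the one-manifold part of X, an open set that is invariant under
    every homeomorphism, and C for its complement.

    Convergence for the topology tau_k of C is continuous convergence on O: a
    family of homeomorphisms u t tends to a when, for each x in O, u t y tends
    to a x as t and y -> x vary together, and likewise for the inverses.  That
    tau_k balls capture such families is compactness of the complement of the
    eps-neighborhood of C, which is contained in O (tau_k_ball_near); the
    converse is that points of O keep a positive distance from C
    (bicvg_cts_balls).  Continuous convergence is visibly stable under
    products and inverses, because O is invariant, so tau_k is a group topology
    (cvg_tau_kP).  It is Hausdorff because a homeomorphism is determined by its
    values on the dense set O.

    For minimality, let sigma be any Hausdorff group topology on the group of
    homeomorphisms; it suffices that the sigma-neighborhoods of the identity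
    converge continuously to it on O.  Two ideas give this.

    - Algebra detects motion.  A nonempty open set U contains an arc, hence
      supports two homeomorphisms f, g that do not commute.  If h moves U off
      itself, then h f h^-1 and g have disjoint supports and so commute.  As
      sigma is Hausdorff and multiplication is continuous, h f h^-1 and g fail
      to commute for all h close to the identity; so the homeomorphisms h such
      that h(U) meets U form a sigma-neighborhood of the identity
      (nbhs_touches).

    - Three small arcs pin down a homeomorphism.  Let U1 < U2 < U3 be
      consecutive open subarcs of an arc contained in V, and let h map a point
      of each Ui back into Ui: h x_i = y_i.  The image by h of the subarc ]x1, x3[
      is connected, contains y2, and misses y1 and y3, which form the frontier
      of the open subarc ]y1, y3[; hence it lies in ]y1, y3[, and h(U2) is
      contained in V (pinning).  The argument is local, so it treats lines and
      circles alike. *)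

Set Implicit Arguments.
Unset Strict Implicit.
Unset Printing Implicit Defensive.

Import Order.TTheory GRing.Theory Num.Theory.
Import numFieldNormedType.Exports.
Import metricType_numDomainType (nbhs_mdistP).

Local Open Scope classical_set_scope.
Local Open Scope ring_scope.

(** * The one-manifold part and its arcs *)

Section OneManifoldPart.
Variables (R : realType) (X : topologicalType).
Let OX := one_manifold_part R X.

Lemma open_one_manifold_part : open OX.
Proof.
rewrite openE => x /= [N + NI]; rewrite {1}nbhsE => -[U [oU Ux] UN].
rewrite /interior nbhsE; exists U => // y Uy; exists N => //.
by apply: filterS UN _; exact: open_nbhs_nbhs.
Qed.

Lemma one_manifold_part_homeo (h : homeo X) (x : X) : OX x -> OX (h x).
Proof.
case=> N Nx [f [g [fK gK cf cg]]].
pose N' : set X := homeo_inv h @^-1` N.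
have N'N (y : N') : N (homeo_inv h (\val y)) by exact: set_mem (valP y).
have NN' (y : N) : N' (h (\val y)).
  by rewrite /N' /preimage /= homeoK; exact: set_mem (valP y).
pose u (y : N') : N := SigSub (mem_set (N'N y)).
pose v (y : N) : N' := SigSub (mem_set (NN' y)).
have uv : cancel u v by move=> y; apply/val_inj; rewrite /= homeoVK.
have vu : cancel v u by move=> y; apply/val_inj; rewrite /= homeoK.
have cu : continuous u.
  apply: continuous_comp_initial => y.
  apply: (@continuous_comp _ _ _ set_val (homeo_inv h)).
    exact: initial_continuous.
  exact: homeoV_continuous.
have cv : continuous v.
  apply: continuous_comp_initial => y.
  apply: (@continuous_comp _ _ _ set_val h); first exact: initial_continuous.
  exact: homeo_continuous.
exists N'.
  by apply: homeoV_continuous; rewrite homeoK.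
exists (f \o u), (v \o g); split; [exact: can_comp|exact: can_comp| |].
- by move=> y; apply: continuous_comp; [exact: cu|exact: cf].
- by move=> y; apply: continuous_comp; [exact: cg|exact: cv].
Qed.

End OneManifoldPart.

Section Arcs.
Variables (R : realType) (X : topologicalType).
Implicit Types (V : set X) (a b : R) (gamma : R -> X).

(** A parametrization gamma of a closed arc, extended continuously to the whole
    line so that no partial functions are involved.  Openness of the open arc
    has to be required: in the plane, say, it fails for every embedded
    interval. *)
Definition is_arc V a b gamma : Prop :=
  [/\ continuous gamma, {in `[a, b] &, injective gamma},
      open (gamma @` `]a, b[) & gamma @` `[a, b] `<=` V].

(** The inverse of a chart at x, restricted to a closed interval around the
    coordinate of x that is short enough for its image to stay inside V and
    inside the interior of the chart. *)
Lemma arc_at (x : X) V : one_manifold_part R X x -> nbhs x V ->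
  exists a b t gamma, [/\ t \in `]a, b[, gamma t = x & is_arc V a b gamma].
Proof.
case=> N Nx [f [g [fK gK cf cg]]] Vx.
pose I : set R := [set` `]0, 1[].
have NX : N x by exact: nbhs_singleton.
pose xN : N := SigSub (mem_set NX).
pose t0 : R := \val (f xN).
have t01 : I t0 by exact: set_mem (valP (f xN)).
(* the arc has to lie in the interior of N, for the openness of its image *)
pose W : set X := N° `&` V°.
have oW : open W by apply: openI; exact: open_interior.
have Wx : W x by split; rewrite /interior.
have W'x : nbhs (g (f xN)) (set_val @^-1` W : set N).
  rewrite fK; apply: (@initial_continuous N X set_val xN).
  exact: open_nbhs_nbhs.
have := cg _ _ W'x => -[_ [[U oU <-] Ut0 UW]].
have : nbhs t0 (I `&` U).
  apply: open_nbhs_nbhs; split => //; apply: openI => //; exact: interval_open.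
move=> /nbhs_ballP[e /= e0 eIU].
pose a := t0 - e / 2; pose b := t0 + e / 2.
have ab s : s \in `[a, b] -> (I `&` U) s.
  rewrite in_itv /= => /andP[sa sb]; apply: eIU.
  rewrite /ball /= ltr_norml; rewrite /a /b in sa sb.
  by apply/andP; split; lra.
(* retraction of the line onto [a, b], which makes gamma total *)
pose clamp (s : R) : R := Num.min b (Num.max a s).
have ltab : a < b by rewrite /a /b; lra.
have clampP s : clamp s \in `[a, b].
  by rewrite in_itv /= /clamp le_min ge_min le_max !lexx (ltW ltab).
have clampid s : s \in `[a, b] -> clamp s = s.
  by rewrite in_itv /= /clamp => /andP[sa sb]; rewrite max_r // min_r.
have cclamp : continuous clamp.
  apply: (@min_fun_continuous _ _ R (cst b) (cst a \max id)).
    by move=> s; exact: cvg_cst.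
  by apply: max_fun_continuous => s; [exact: cvg_cst|exact: cvg_id].
pose cl (s : R) : I := SigSub (mem_set (ab _ (clampP s)).1).
have ccl : continuous cl by apply: continuous_comp_initial.
pose gamma s : X := \val (g (cl s)).
have clE s : s \in `[a, b] -> \val (cl s) = s by move=> /clampid.
have gW s : W (gamma s).
  apply: (UW (cl s)); exact: (ab _ (clampP s)).2.
exists a, b, t0, gamma; split.
- by rewrite in_itv /= /a /b; apply/andP; split; lra.
- rewrite /gamma (_ : cl t0 = f xN) ?fK //; apply: val_inj => /=.
  by apply: clampid; rewrite in_itv /= /a /b; apply/andP; split; lra.
split.
- move=> s; apply: (@continuous_comp _ _ _ (g \o cl) set_val).
    by apply: continuous_comp; [exact: ccl|exact: cg].
  exact: initial_continuous.
- move=> s s' /clE sE /clE s'E /val_inj /(can_inj gK) /(congr1 val).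
  by rewrite /= in sE s'E *; rewrite sE s'E.
- have : open (f @^-1` (set_val @^-1` `]a, b[)).
    move/continuousP : cf; apply.
    have /continuousP := @initial_continuous I R set_val; apply.
    exact: interval_open.
  move=> [B oB BE].
  suff -> : gamma @` `]a, b[ = B `&` W by exact: openI.
  have sub : {subset `]a, b[ <= `[a, b]} by exact: subset_itv_oo_cc.
  apply/seteqP; split=> [_ [s sab <-]|y [By Wy]].
    split; last exact: gW.
    rewrite -[B _]/((set_val @^-1` B) (g (cl s))) BE /preimage /= gK.
    by rewrite /= (_ : set_val _ = s) //; apply: clE; exact: sub.
  have Ny : N y by exact: (nbhs_singleton Wy.1).
  pose yN : N := SigSub (mem_set Ny).
  have : (set_val @^-1` B) yN by [].
  rewrite BE /preimage /= => fyab; exists (\val (f yN)) => //.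
  rewrite /gamma (_ : cl _ = f yN) ?fK //; apply: val_inj => /=.
  by apply: clampid; exact: sub.
- by move=> _ [s _ <-]; exact: (nbhs_singleton (gW s).2).
Qed.

Section ArcTheory.
Hypothesis hX : hausdorff_space X.
Variables (V : set X) (a b : R) (gamma : R -> X).
Hypothesis ga : is_arc V a b gamma.

(** Closed subsets of [a, b] are compact, and so are their images. *)
Lemma arc_closed (A : set R) : closed A -> A `<=` `[a, b] ->
  closed (gamma @` A).
Proof.
case: ga => cg _ _ _ cA sA; apply: compact_closed => //.
apply: continuous_compact; first exact: continuous_subspaceT.
exact: subclosed_compact (@segment_compact R a b) sA.
Qed.

(** An open subarc is the whole open arc minus two closed, hence compact, end
    pieces. *)
Lemma subarc c d : a <= c -> d <= b -> is_arc V c d gamma.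
Proof.
case: (ga) => cg ig og gV ac db.
have sub : {subset `[c, d] <= `[a, b]} by apply: subset_itv; rewrite bnd_simp.
split => //.
- by move=> s t /sub ? /sub ?; exact: ig.
- rewrite (_ : _ @` _ =
    gamma @` `]a, b[ `&` ~` (gamma @` (`[a, b] `&` ~` `]c, d[))).
    apply: openI => //; apply: closed_openC; apply: arc_closed.
      apply: closedI; first exact: interval_closed.
      by apply: open_closedC; exact: interval_open.
    by move=> s [].
  have sub' : {subset `]c, d[ <= `]a, b[}.
    by apply: subset_itv; rewrite bnd_simp.
  apply/seteqP; split=> [_ [s scd <-]|_ [[s sab <-]]].
    split; first by exists s => //; exact: sub'.
    case=> t [tab tcd] ts; apply: tcd; rewrite (_ : t = s) //.
    by apply: ig => //; apply: sub; exact: subset_itv_oo_cc.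
  move=> sN; exists s => //; apply: contrapT => scd; apply: sN; exists s => //.
  by split => //; exact: subset_itv_oo_cc.
- by move=> _ [s /sub sab <-]; apply: gV; exists s.
Qed.

(** The candidate for a homeomorphism supported in the arc.  The coordinate of a
    point of the arc is recovered by choice; it is unique by injectivity. *)
Definition along_arc (beta : R -> R) (y : X) : X :=
  if pselect (exists2 s, s \in `[a, b] & gamma s = y) is left ys
  then gamma (beta (projT1 (cid2 ys))) else y.

Lemma along_arcE beta s : s \in `[a, b] ->
  along_arc beta (gamma s) = gamma (beta s).
Proof.
case: ga => _ ig _ _ sab; rewrite /along_arc; case: pselect => [ys|[]].
  by case: cid2 => t /= tab /ig ->.
by exists s.
Qed.

Lemma along_arc_out beta y : ~ (gamma @` `[a, b]) y -> along_arc beta y = y.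
Proof. by move=> ny; rewrite /along_arc; case: pselect. Qed.

(** The closed arc and the complement of the open arc are closed and cover X.
    The map is continuous on each, and both descriptions agree at the two end
    points, which beta fixes. *)
Lemma along_arc_continuous beta : continuous beta ->
  beta a = a -> beta b = b -> continuous (along_arc beta).
Proof.
move=> cb ba bb; apply/continuous_closedP => D cD.
rewrite (_ : _ @^-1` _ =
  gamma @` (`[a, b] `&` (gamma \o beta) @^-1` D) `|`
  (D `&` ~` (gamma @` `]a, b[))).
  case: (ga) => cg _ og _; apply: closedU.
    apply: arc_closed; last by move=> s [].
    apply: closedI; first exact: interval_closed.
    apply: (proj1 (continuous_closedP _)) cD => s.
    by apply: continuous_comp; [exact: cb|exact: cg].
  by apply: closedI => //; exact: open_closedC.
apply/seteqP; split=> y /=.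
  have [[s sab <-]|nab] := pselect ((gamma @` `[a, b]) y).
    by rewrite along_arcE // => Dy; left; exists s.
  rewrite along_arc_out // => Dy; right; split => // -[s sab sy].
  by apply: nab; exists s => //; exact: subset_itv_oo_cc.
case=> [[s [sab Ds] <-]|[Dy nab]]; first by rewrite along_arcE.
have [[s sab sy]|] := pselect ((gamma @` `[a, b]) y); last first.
  by move=> ?; rewrite along_arc_out.
rewrite -sy along_arcE //.
(* s is an end point, as the open arc does not contain gamma s *)
suff -> : beta s = s by rewrite sy.
have [->//|sa] := eqVneq s a; have [->//|sb] := eqVneq s b.
case: nab; exists s => //; move: sab; rewrite /= !in_itv /= => /andP[as_ sb'].
by rewrite !lt_neqAle as_ sb' sb eq_sym sa.
Qed.

Lemma along_arcK beta beta' : {homo beta : s / s \in `[a, b]} ->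
  cancel beta beta' -> cancel (along_arc beta) (along_arc beta').
Proof.
move=> hb bK y; have [[s sab <-]|nab] := pselect ((gamma @` `[a, b]) y).
  by rewrite !along_arcE ?bK //; exact: hb.
by rewrite !along_arc_out.
Qed.

(** The moving map of the interval [a, b] is the concave piecewise linear
    homeomorphism with slope 2 at a and slope 1/2 at b, and the identity outside
    [a, b].  Written with max and min, its inverse is obtained by exchanging max
    with min and inverting each of the three affine maps. *)
Lemma arc_bump : exists h : homeo X,
  (forall y, ~ V y -> h y = y) /\
  (forall s, s \in `]a, b[ -> h (gamma s) <> gamma s).
Proof.
have [ltab|leba] := ltP a b; last first.
  exists (homeo1 X); split => // s; rewrite in_itv /= => /andP[sa sb].
  by have := lt_le_trans (lt_trans sa sb) leba; rewrite ltxx.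
pose beta (s : R) : R := Num.max s (Num.min (2 * s - a) ((s + b) / 2)).
pose beta' (s : R) : R := Num.min s (Num.max ((s + a) / 2) (2 * s - b)).
have bK : cancel beta beta'.
  move=> s; rewrite /beta /beta'.
  case: (leP (2 * s - a) ((s + b) / 2)) => h1;
    case: (leP s _) => h2; case: (leP (_ / 2) _) => h3;
    case: (leP _ _) => h4; lra.
have b'K : cancel beta' beta.
  move=> s; rewrite /beta /beta'.
  case: (leP ((s + a) / 2) (2 * s - b)) => h1;
    case: (leP s _) => h2; case: (leP (_ - a) _) => h3;
    case: (leP _ _) => h4; lra.
have cid : continuous (@idfun R) by move=> s; exact: cvg_id.
have cl (u v : R) : continuous (fun s : R => (u * s + v : R)).
  move=> s; apply: cvgD; last exact: cvg_cst.
  by apply: cvgM; [exact: cvg_cst|exact: cvg_id].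
have cb : continuous beta.
  rewrite (_ : beta = idfun \max ((fun s => 2 * s + - a) \min
    (fun s => 2^-1 * s + b / 2))).
    by apply: max_fun_continuous => //; apply: min_fun_continuous; exact: cl.
  by apply/funext => s; rewrite /beta /= [(s + b) / 2]mulrDl [s / 2]mulrC.
have cb' : continuous beta'.
  rewrite (_ : beta' = idfun \min ((fun s => 2^-1 * s + a / 2) \max
    (fun s => 2 * s + - b))).
    by apply: min_fun_continuous => //; apply: max_fun_continuous; exact: cl.
  by apply/funext => s; rewrite /beta' /= [(s + a) / 2]mulrDl [s / 2]mulrC.
have ba : beta a = a.
  by rewrite /beta; case: (leP (_ - a) _) => h1; case: (leP a _) => h2; lra.
have bb : beta b = b.
  by rewrite /beta; case: (leP (_ - a) _) => h1; case: (leP b _) => h2; lra.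
have b'a : beta' a = a by rewrite -{1}ba bK.
have b'b : beta' b = b by rewrite -{1}bb bK.
have hb : {homo beta : s / s \in `[a, b]}.
  move=> s; rewrite !in_itv /beta /= => /andP[sa sb].
  by case: (leP (_ - a) _) => h1; case: (leP s _) => h2; apply/andP; split; lra.
have hb' : {homo beta' : s / s \in `[a, b]}.
  move=> s; rewrite !in_itv /beta' /= => /andP[sa sb].
  by case: (leP (_ / 2) _) => h1; case: (leP s _) => h2; apply/andP; split; lra.
exists (Homeo (along_arcK hb bK) (along_arcK hb' b'K)
  (along_arc_continuous cb ba bb) (along_arc_continuous cb' b'a b'b)).
split=> [y nVy|s sab] /=.
  by apply: along_arc_out; case: ga => _ _ _ gV; exact: contra_not (@gV y) nVy.
have sab' : s \in `[a, b] by exact: subset_itv_oo_cc.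
rewrite along_arcE //; case: ga => _ ig _ _ /ig - /(_ (hb _ sab') sab').
move: sab; rewrite in_itv /beta /= => /andP[sa sb].
by case: (leP (_ - a) _) => h1; case: (leP s _) => h2; lra.
Qed.

End ArcTheory.

Lemma exists_bump (x : X) V : hausdorff_space X ->
    one_manifold_part R X x -> nbhs x V ->
  exists2 h : homeo X, (forall y, ~ V y -> h y = y) & h x <> x.
Proof.
move=> hX /arc_at /[apply] -[a [b [t [gamma [tab <- gV]]]]].
by have [h [hV hm]] := arc_bump hX gV; exists h => //; exact: hm.
Qed.

(** Let f move x inside V, then let g move x within a neighborhood that avoids
    f x: then g f x = f x, while f g x differs from f x. *)
Lemma exists_noncommuting (x : X) V : hausdorff_space X ->
    one_manifold_part R X x -> nbhs x V ->
  exists f g : homeo X, [/\ forall y, ~ V y -> f y = y,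
    forall y, ~ V y -> g y = y & (f * g <> g * f)%g].
Proof.
move=> hX Ox Vx; have [f fV fx] := exists_bump hX Ox Vx.
have Wx : nbhs x (V `&` [set y | y <> f x]).
  apply: filterI => //; apply: open_nbhs_nbhs; split; last by move=> /esym.
  apply: closed_openC.
  exact: (accessible_closed_set1 (hausdorff_accessible hX)).
have [g gW gx] := exists_bump hX Ox Wx; exists f, g; split => //.
  by move=> y nVy; apply: gW => -[].
move=> /(congr1 (fun h : homeo X => h x)) /= fg.
have : f (g x) = f x by rewrite [LHS]fg; apply: gW => -[].
by move=> /(can_inj (@homeoK _ f)).
Qed.

End Arcs.

(** * Homeomorphisms that keep small arcs in touch with themselves *)

Section Pinning.
Variables (R : realType) (X : topologicalType).
Hypothesis hX : hausdorff_space X.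

(** The image C of the open subarc ]s1, s3[ is connected and meets the open
    subarc ]t1, t3[ at h (gamma s2).  It misses gamma t1 and gamma t3, the
    images by h of the points of parameters s1 and s3; so the open and the
    closed subarc have the same trace on C, and this trace is clopen in C. *)
Lemma arc_pinned (V : set X) (a b : R) gamma (h : homeo X) s1 s2 s3 t1 t2 t3 :
    is_arc V a b gamma ->
    a <= s1 -> s1 < s2 < s3 -> s3 <= b -> a <= t1 -> t1 < t2 < t3 -> t3 <= b ->
    h (gamma s1) = gamma t1 -> h (gamma s2) = gamma t2 ->
    h (gamma s3) = gamma t3 ->
  forall s, s \in `]s1, s3[ -> V (h (gamma s)).
Proof.
move=> ga as1 /andP[s12 s23] s3b at1 /andP[t12 t23] t3b h1 h2 h3 s ss.
have [cg ig _ gV] := ga.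
have [_ _ oD _] := subarc hX ga at1 t3b.
have tsub t : t \in `[t1, t3] -> t \in `[a, b].
  by apply: subset_itv; rewrite bnd_simp.
have cE : closed (gamma @` `[t1, t3]).
  by apply: (arc_closed hX ga) => //; exact: interval_closed.
pose C := (h \o gamma) @` `]s1, s3[.
have conC : connected C.
  apply: connected_continuous_connected.
    exact/connected_intervalP/interval_is_interval.
  apply: continuous_subspaceT => r.
  by apply: continuous_comp; [exact: cg|exact: homeo_continuous].
have CD : C `&` gamma @` `]t1, t3[ = C `&` gamma @` `[t1, t3].
  apply/seteqP; split=> y [Cy [t tt ty]]; split => //; exists t => //.
    exact: subset_itv_oo_cc.
  case: Cy => r rr /= ry.
  have rsub : r \in `[a, b].
    by move: rr; rewrite /= !in_itv /= => /andP[? ?]; apply/andP; split; lra.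
  have ne u : u \in `[a, b] -> u \notin `]s1, s3[ -> y <> h (gamma u).
    move=> uab us yu; move: ry; rewrite yu => /(can_inj (@homeoK _ h)) /ig ru.
    by move: us; rewrite -ru // rr.
  have tt1 : t != t1.
    apply/eqP => tE; apply: (ne s1); rewrite ?h1 -?tE //.
      by rewrite in_itv /=; apply/andP; split; lra.
    by rewrite in_itv /= ltxx.
  have tt3 : t != t3.
    apply/eqP => tE; apply: (ne s3); rewrite ?h3 -?tE //.
      by rewrite in_itv /=; apply/andP; split; lra.
    by rewrite in_itv /= ltxx andbF.
  move: tt; rewrite /= !in_itv /= => /andP[t1t tt3'].
  by rewrite !lt_neqAle t1t tt3' tt3 eq_sym tt1.
have CE : C `&` gamma @` `]t1, t3[ = C.
  apply: conC.
  - exists (gamma t2); split.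
      by exists s2 => //=; rewrite in_itv /= s12.
    by exists t2 => //=; rewrite in_itv /= t12.
  - by exists (gamma @` `]t1, t3[).
  - by exists (gamma @` `[t1, t3]).
have : C (h (gamma s)) by exists s.
rewrite -CE => -[_ [t tt <-]]; apply: gV; exists t => //.
by apply: tsub; exact: subset_itv_oo_cc.
Qed.

Definition touches (U : set X) (h : homeo X) : Prop := exists2 x, U x & U (h x).

(** A neighborhood of the identity cut out by such conditions is therefore
    symmetric: estimates for h on it hold for its inverse too. *)
Lemma touchesV U h : touches U h -> touches U (h^-1)%g.
Proof. by case=> x Ux Uhx; exists (h x) => //=; rewrite homeoK. Qed.

(** The middle of three consecutive subarcs serves as the neighborhood of x
    on which h is controlled. *)
Lemma pinning (x : X) (V : set X) : one_manifold_part R X x -> nbhs x V ->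
  exists U1 U2 U3 : set X,
    [/\ open U1 /\ U1 !=set0, nbhs x U2 /\ open U2, open U3 /\ U3 !=set0 &
     forall h, touches U1 h -> touches U2 h -> touches U3 h ->
       forall y, U2 y -> V (h y)].
Proof.
move=> /arc_at /[apply] -[a [b [t [gamma [tab <- ga]]]]].
move: tab; rewrite in_itv /= => /andP[ta tb].
pose c := (a + t) / 2; pose d := (t + b) / 2.
have ac : a < c by rewrite /c; lra.
have ct : c < t by rewrite /c; lra.
have td : t < d by rewrite /d; lra.
have db : d < b by rewrite /d; lra.
have oU u v : a <= u -> v <= b -> open (gamma @` `]u, v[).
  by move=> au vb; have [] := subarc hX ga au vb.
exists (gamma @` `]a, c[), (gamma @` `]c, d[), (gamma @` `]d, b[); split.
- split; first by apply: oU; lra.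
  exists (gamma ((a + c) / 2)), ((a + c) / 2) => //=.
  by rewrite in_itv /=; apply/andP; split; lra.
- split; last by apply: oU; lra.
  apply: open_nbhs_nbhs; split; first by apply: oU; lra.
  by exists t; rewrite //= in_itv /= ct.
- split; first by apply: oU; lra.
  exists (gamma ((d + b) / 2)), ((d + b) / 2) => //=.
  by rewrite in_itv /=; apply/andP; split; lra.
move=> h [_ [s1 + <-] [t1 + /esym h1]] [_ [s2 + <-] [t2 + /esym h2]].
rewrite /= !in_itv /= => /andP[? ?] /andP[? ?] /andP[? ?] /andP[? ?].
case=> [_ [s3 + <-] [t3 + /esym h3]] _ [s + <-].
rewrite /= !in_itv /= => /andP[? ?] /andP[? ?] /andP[? ?].
apply: (arc_pinned ga _ _ _ _ _ _ h1 h2 h3); rewrite ?in_itv /=;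
  try (apply/andP; split); lra.
Qed.

(** The homeomorphism h * f * h^-1 is supported in h(U), which is disjoint from
    U, where g is supported. *)
Lemma disjoint_supports_commute (U : set X) (f g h : homeo X) :
    (forall y, ~ U y -> f y = y) -> (forall y, ~ U y -> g y = y) ->
    ~ touches U h ->
  (h * f * h^-1 * g = g * (h * f * h^-1))%g.
Proof.
have stable (k : homeo X) : (forall y, ~ U y -> k y = y) ->
    forall y, U y -> U (k y).
  move=> kU y Uy; apply: contrapT => nU; apply: (nU).
  by rewrite (can_inj (@homeoK _ k) (kU _ nU)).
move=> fU gU nh; apply: homeo_ext => y /=.
have disj z : U z -> ~ U (homeo_inv h z).
  by move=> Uz Uhz; apply: nh; exists (homeo_inv h z) => //; rewrite homeoVK.
have [Uy|nUy] := pselect (U y).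
  by rewrite !fU ?homeoVK //; apply: disj => //; exact: stable.
rewrite [in LHS]gU // [in RHS]gU //.
have [Uhy|nUhy] := pselect (U (homeo_inv h y)).
  by move=> Uhf; apply: nh; exists (f (homeo_inv h y)) => //; exact: stable.
by rewrite fU // homeoVK.
Qed.

End Pinning.

Section GroupTopologies.
Variables (G : groupType) (sigma : set_system G) (top : is_topology sigma).
Let T : topologicalType := topologized top.
Hypothesis mul_cont : continuous (fun p : T * T =>
  ((p.1 : G) * (p.2 : G))%g : T).

Lemma cvg_mulg (I : Type) (F : set_system I) (u v : I -> T)
    (a b : T) {FF : Filter F} :
  u @ F --> a -> v @ F --> b ->
  (fun t => ((u t : G) * (v t : G))%g : T) @ F --> (((a : G) * (b : G))%g : T).
Proof.
move=> ua vb; pose m (p q : T) : T := ((p : G) * (q : G))%g.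
exact: (cvg_comp2 (h := m) ua vb (@mul_cont (a, b))).
Qed.

End GroupTopologies.

Section HausdorffGroupTopologies.
Variables (R : realType) (X : topologicalType).
Hypothesis hX : hausdorff_space X.
Hypothesis dense_OX : dense (one_manifold_part R X).
Variables (sigma : set_system (homeo X)) (top : is_topology sigma).
Let T : topologicalType := topologized top.
Hypothesis mul_cont : continuous (fun p : T * T =>
  ((p.1 : homeo X) * (p.2 : homeo X))%g : T).
Hypothesis inv_cont : continuous (fun x : T => ((x : homeo X)^-1)%g : T).
Hypothesis haus : hausdorff_space T.

Let one : T := (1%g : homeo X).

(** Noncommutation is an open condition on h in a Hausdorff group topology, and
    it holds at the identity for the pair f, g supported in U. *)
Lemma nbhs_touches (U : set X) : open U -> U !=set0 ->
  nbhs one (touches U).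
Proof.
move=> oU U0; have [x [Ux Ox]] := dense_OX U0 oU.
have Ux' : nbhs x U by exact: open_nbhs_nbhs.
have [f [g [fU gU fg]]] := exists_noncommuting hX Ox Ux'.
(* disjoint open sets of sigma separating f * g from g * f *)
move: haus; rewrite open_hausdorff.
move=> /(_ (f * g : homeo X)%g (g * f : homeo X)%g) [|[A B] /=].
  exact/eqP.
move=> [/set_mem Afg /set_mem Bgf] [oA oB /eqP AB].
pose conj (h : T) : T := ((h : homeo X) * f * (h : homeo X)^-1)%g.
have cid : id @ one --> one by exact: cvg_id.
have ccst (k : T) : (fun=> k) @ one --> k.
  exact: (@cvg_cst T k T (nbhs one) _).
have cconj : conj @ one --> (f : T).
  suff : conj @ one -->
      (((one : homeo X) * f * (one : homeo X)^-1)%g : T).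
    by rewrite /one invg1 mulg1 mul1g.
  exact: (cvg_mulg mul_cont (cvg_mulg mul_cont cid (ccst f))
    (@inv_cont one)).
have hA : \forall h \near one, A ((conj h : homeo X) * g)%g.
  by apply: (cvg_mulg mul_cont cconj (ccst g)); exact: open_nbhs_nbhs.
have hB : \forall h \near one, B (g * (conj h : homeo X))%g.
  by apply: (cvg_mulg mul_cont (ccst g) cconj); exact: open_nbhs_nbhs.
near=> h; apply: contrapT => nh.
have := disjoint_supports_commute fU gU nh => E.
have : (A `&` B) (g * (conj h : homeo X))%g.
  by split; [rewrite -E|]; near: h.
by rewrite AB.
Unshelve. all: by end_near.
Qed.

End HausdorffGroupTopologies.

(** * Continuous convergence on the one-manifold part *)

Section ContinuousConvergence.
Variables (R : realType) (X : topologicalType).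
Let OX := one_manifold_part R X.

(** Continuous convergence on the one-manifold part, for families indexed by an
    arbitrary filter so that products of families need no separate treatment. *)
Definition cvg_cts (T : Type) (F : set_system T) (u : T -> homeo X)
    (a : homeo X) : Prop :=
  forall x V, OX x -> nbhs (a x) V ->
    \forall y \near x & t \near F, V (u t y).

Definition bicvg_cts (T : Type) (F : set_system T) (u : T -> homeo X)
    (a : homeo X) : Prop :=
  cvg_cts F u a /\ cvg_cts F (fun t => (u t)^-1)%g (a^-1)%g.

(** Invariance of the one-manifold part lets the convergence of u be used at
    the point b x. *)
Lemma cvg_ctsM (T : Type) (F : set_system T) {FF : Filter F}
    (u v : T -> homeo X) (a b : homeo X) :
  cvg_cts F u a -> cvg_cts F v b -> cvg_cts F (fun t => u t * v t)%g (a * b)%g.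
Proof.
move=> ua vb x V Ox Vx.
have [[/= A B] [Abx FB] AB] := ua _ _ (one_manifold_part_homeo b Ox) Vx.
have [[/= C D] [Cx FD] CD] := vb _ _ Ox Abx.
exists (C, B `&` D); first by split => //; exact: filterI.
move=> [y t] /= [Cy [Bt Dt]]; apply: (AB (v t y, t)); split => //.
exact: (CD (y, t)).
Qed.

Lemma bicvg_ctsM (T : Type) (F : set_system T) {FF : Filter F}
    (u v : T -> homeo X) (a b : homeo X) :
  bicvg_cts F u a -> bicvg_cts F v b ->
  bicvg_cts F (fun t => u t * v t)%g (a * b)%g.
Proof.
move=> [ua ua'] [vb vb']; split; first exact: cvg_ctsM.
rewrite invgM (_ : (fun t => _) = fun t => ((v t)^-1 * (u t)^-1)%g).
  exact: cvg_ctsM.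
by apply/funext => t; rewrite invgM.
Qed.

Lemma bicvg_ctsV (T : Type) (F : set_system T) (u : T -> homeo X)
    (a : homeo X) :
  bicvg_cts F u a -> bicvg_cts F (fun t => (u t)^-1)%g (a^-1)%g.
Proof. by move=> [ua ua']. Qed.

Lemma cvg_cts_cst (T : Type) (F : set_system T) {FF : Filter F} (a : homeo X) :
  cvg_cts F (fun=> a) a.
Proof.
move=> x V Ox Vx; exists (a @^-1` V, setT).
  by split; [exact: homeo_continuous|exact: filterT].
by move=> [y t] [].
Qed.

Lemma bicvg_cts_cst (T : Type) (F : set_system T) {FF : Filter F}
    (a : homeo X) :
  bicvg_cts F (fun=> a) a.
Proof. by split; exact: cvg_cts_cst. Qed.

Lemma cvg_cts_comp (S T : Type) (F : set_system S) (G : set_system T)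
    (p : S -> T) (u : T -> homeo X) (a : homeo X) :
  p @ F --> G -> cvg_cts G u a -> cvg_cts F (u \o p) a.
Proof.
move=> FG ua x V Ox Vx; have [[/= A B] [Ax GB] AB] := ua _ _ Ox Vx.
exists (A, p @^-1` B); first by split => //; exact: FG.
by move=> [y s] /= [Ay Bs]; exact: (AB (y, p s)).
Qed.

Lemma bicvg_cts_comp (S T : Type) (F : set_system S) (G : set_system T)
    (p : S -> T) (u : T -> homeo X) (a : homeo X) :
  p @ F --> G -> bicvg_cts G u a -> bicvg_cts F (u \o p) a.
Proof.
move=> FG [ua ua'].
by split; [exact: cvg_cts_comp ua|exact: cvg_cts_comp ua'].
Qed.

End ContinuousConvergence.

(** * The topology tau_k *)

Section TauK.
Variables (R : realType) (X : metricType R).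
Hypothesis compactX : compact [set: X].
Let OX := one_manifold_part R X.
Let C := ~` OX.
Let ball_k := tau_k_ball C.

Lemma eps_nbhdP (A : set X) e x :
  eps_nbhd A e x <-> exists2 c, A c & mdist x c < e.
Proof.
rewrite /eps_nbhd /=; split.
  by move=> /ereal_inf_lt[_ [c Ac <-]]; rewrite lte_fin => ?; exists c.
move=> [c Ac xc]; apply/ereal_inf_ltP; exists (mdist x c)%:E.
  by exists c.
by rewrite lte_fin.
Qed.

Lemma open_eps_nbhd (A : set X) e : open (eps_nbhd A e).
Proof.
rewrite openE => x /eps_nbhdP[c Ac xc]; apply/nbhs_mdistP.
exists (e - mdist x c) => /=; first by rewrite subr_gt0.
move=> y /= xy; apply/eps_nbhdP; exists c => //.
have := metric_triangle y x c; rewrite (metric_sym y x); lra.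
Qed.

Lemma tau_k_ball_mono d e : d <= e -> ball_k d `<=` ball_k e.
Proof.
move=> de h hd x nx; have [] := hd x.
  move=> /eps_nbhdP[c Ac xc]; apply: nx; apply/eps_nbhdP; exists c => //.
  exact: lt_le_trans de.
by move=> h1 h2; split; exact: lt_le_trans de.
Qed.

Definition ball_filter : set_system (homeo X) :=
  filter_from [set e : R | 0 < e] ball_k.

Lemma tau_k_ball1 e : 0 < e -> ball_k e 1%g.
Proof. by move=> e0 x _; rewrite /= mdistxx. Qed.

#[local] Instance ball_filter_filter : Filter ball_filter.
Proof.
apply: filter_from_filter; first by exists 1 => /=.
move=> d e /= d0 e0; exists (Num.min d e); first by rewrite lt_min d0.
by move=> h hde; split; apply: tau_k_ball_mono hde; rewrite ge_min lexx ?orbT.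
Qed.

(** A point x of the one-manifold part has a neighborhood at distance at least
    e from its complement, for some e; on it all members of the ball of radius e
    move points by less than e. *)
Lemma bicvg_cts_balls : bicvg_cts R ball_filter id 1%g.
Proof.
suff main x V : OX x -> nbhs x V -> \forall y \near x & g \near ball_filter,
    V ((g : homeo X) y) /\ V ((g^-1)%g y).
  by split=> x V Ox Vx; have := main x V Ox Vx; apply: filterS => p [].
move=> Ox Vx; have : nbhs x (V `&` OX).
  apply: filterI => //; apply: open_nbhs_nbhs; split => //.
  exact: open_one_manifold_part.
move=> /nbhs_mdistP[e /= e0 eVO].
exists ([set y | mdist x y < e / 2], ball_k (e / 2)).
  split; first by apply/nbhs_mdistP; exists (e / 2) => //=; lra.
  by exists (e / 2) => //=; lra.
move=> [y g] /= [xy gB].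
have [|gy gy'] := gB y.
  move=> /eps_nbhdP[c Cc yc]; have [//|_] := eVO c.
    by rewrite /=; have := metric_triangle x y c; lra.
  by move: Cc.
split; apply: (eVO _ _).1 => /=.
  by have := metric_triangle x y (g y); rewrite (metric_sym y); lra.
by have := metric_triangle x y ((g^-1)%g y); rewrite (metric_sym y); lra.
Qed.

Lemma cvg_cts_close (T : Type) (F : set_system T) (u : T -> homeo X) a x e :
    cvg_cts R F u a -> OX x -> mdist (a x) x < e ->
  \forall y \near x & t \near F, mdist (u t y) y < e.
Proof.
move=> ua Ox axe; pose r := (e - mdist (a x) x) / 2.
have r0 : 0 < r by rewrite /r; lra.
have : nbhs (a x) [set z | mdist (a x) z < r].
  by apply/nbhs_mdistP; exists r.
move=> /(ua _ _ Ox)[[/= A B] [Ax FB] AB].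
exists (A `&` [set y | mdist x y < r], B).
  by split => //; apply: filterI => //; apply/nbhs_mdistP; exists r.
move=> [y t] /= [[Ay xy] Bt]; have := AB (y, t) (conj Ay Bt).
rewrite /= => axu; have := metric_triangle (u t y) (a x) y.
have := metric_triangle (a x) x y; rewrite (metric_sym (u t y) (a x)).
by move: axu xy; rewrite /r; lra.
Qed.

(** The condition defining the ball is checked at each point of a compact subset
    of the one-manifold part; continuous convergence makes it hold near each
    point, uniformly in t, and compactness makes it hold everywhere at once.
    With u converging to a member a of the ball, this also says that balls are
    open. *)
Lemma tau_k_ball_near (T : Type) (F : set_system T) {FF : Filter F}
    (u : T -> homeo X) a e :
  ball_k e a -> bicvg_cts R F u a -> \forall t \near F, ball_k e (u t).
Proof.
move=> ae [ua ua'].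
have cK : compact (~` eps_nbhd C e).
  apply: (subclosed_compact _ compactX) => //.
  by apply: open_closedC; exact: open_eps_nbhd.
move/compact_near_coveringP : cK => /(_ _ F (fun t x =>
  mdist (u t x) x < e /\ mdist ((u t)^-1%g x) x < e) FF); apply.
move=> x nx; have [axe axe'] := ae x nx.
have Ox : OX x.
  apply: contrapT => Cx; apply: nx; apply/eps_nbhdP; exists x => //.
  by rewrite mdistxx; apply: le_lt_trans axe; exact: mdist_ge0.
have n1 := cvg_cts_close ua Ox axe; have n2 := cvg_cts_close ua' Ox axe'.
exact: filterI n1 n2.
Qed.

(** Unions of translates of balls are the sets that contain, around each of
    their points h, a translate h B of a ball: translates of balls have this
    property because a ball is open. *)
Lemma tau_kP (U : set (homeo X)) :
  tau_k C U <-> forall h, U h -> \forall g \near ball_filter, U (h * g)%g.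
Proof.
split=> [[F F0 ->] _ [[a e] Fae [h he <-]]|oU].
  have e0 : 0 < e := F0 _ Fae.
  have hg : bicvg_cts R ball_filter (fun g => h * g)%g h.
    rewrite -[X in bicvg_cts _ _ _ X]mulg1.
    by apply: bicvg_ctsM; [exact: bicvg_cts_cst|exact: bicvg_cts_balls].
  apply: filterS (tau_k_ball_near he hg) => g hge.
  by exists (a, e) => //; exists (h * g)%g => //=; rewrite mulgA.
pose F := [set p : homeo X * R |
  [/\ U p.1, 0 < p.2 & forall g, ball_k p.2 g -> U (p.1 * g)%g]].
exists F; first by move=> p [].
apply/seteqP; split=> [h Uh|_ [p [_ _ pU] [g gB <-]]]; last exact: pU.
have [e /= e0 eU] := oU h Uh; exists (h, e); first by split.
by exists 1%g; [exact: tau_k_ball1|rewrite mulg1].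
Qed.

Lemma tau_k_topology : is_topology (tau_k C).
Proof.
split.
- by apply/tau_kP => h _; exact: filterT.
- move=> U V /tau_kP oU /tau_kP oV; apply/tau_kP => h [Uh Vh].
  by apply: filterI; [exact: oU|exact: oV].
- move=> I F oF; apply/tau_kP => h [i _ Fih].
  have /tau_kP/(_ _ Fih) := oF i.
  by apply: filterS => g; exists i.
Qed.

Let T : topologicalType := topologized tau_k_topology.

Lemma nbhs_tau_k (a : T) (U : set T) :
  nbhs a U <-> \forall g \near ball_filter, U ((a : homeo X) * g)%g.
Proof.
split=> [[V [/tau_kP oV Va VU]]|[e /= e0 eU]].
  by have := oV _ Va; apply: filterS => g /VU.
exists [set ((a : homeo X) * g)%g | g in ball_k e]; split.
- exists [set ((a : homeo X), e)]; first by move=> _ ->.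
  by rewrite bigcup_set1.
- by exists 1%g; [exact: tau_k_ball1|rewrite mulg1].
- by move=> _ [g gB <-]; exact: eU.
Qed.

(** This turns every continuity statement about tau_k into one about continuous
    convergence. *)
Lemma cvg_tau_kP (I : Type) (F : set_system I) {FF : Filter F}
    (u : I -> homeo X) (a : T) :
  u @ F --> a <-> bicvg_cts R F u a.
Proof.
split=> [ua|ua U /nbhs_tau_k[e /= e0 eU]].
  rewrite (_ : u = (id : T -> homeo X) \o u) //; apply: bicvg_cts_comp ua _.
  have -> : (id : T -> homeo X) = (fun g => a * (a^-1 * g))%g.
    by apply/funext => g; rewrite mulVKg.
  rewrite -[X in bicvg_cts _ _ _ X]mulg1.
  apply: bicvg_ctsM; first exact: bicvg_cts_cst.
  apply: (@bicvg_cts_comp _ _ _ _ _ ball_filter (fun g => a^-1 * g)%g id).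
    move=> U BU; apply/nbhs_tau_k; apply: filterS BU => g Bg.
    by rewrite /preimage /= mulKg.
  exact: bicvg_cts_balls.
have au : bicvg_cts R F (fun t => a^-1 * u t)%g 1%g.
  rewrite -(mulVg (a : homeo X)).
  by apply: bicvg_ctsM => //; exact: bicvg_cts_cst.
apply: filterS (tau_k_ball_near (tau_k_ball1 e0) au) => t /eU.
by rewrite mulVKg.
Qed.

Lemma tau_k_hausdorff_group_topology : dense OX ->
  hausdorff_group_topology (tau_k C).
Proof.
move=> dO; exists tau_k_topology.
have cid (a : T) : bicvg_cts R (nbhs a) (id : T -> homeo X) a.
  exact/cvg_tau_kP/cvg_id.
split.
- move=> [a b]; apply/cvg_tau_kP; apply: bicvg_ctsM.
    by apply: bicvg_cts_comp (cid a); exact: cvg_fst.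
  by apply: bicvg_cts_comp (cid b); exact: cvg_snd.
- move=> a; apply: (proj2 (@cvg_tau_kP T (nbhs (a : T)) _ _ _)).
  exact: bicvg_ctsV (cid a).
- move=> a b ab; apply: homeo_ext.
  have fix_O x : OX x -> a x = b x.
    move=> Ox; apply: metric_hausdorff => U V Uax Vbx.
    have ev (c : T) W : nbhs (c x) W -> \forall g \near c, W ((g : homeo X) x).
      move=> Wcx; have [[/= A B] [Ax cB] AB] := (cid c).1 x W Ox Wcx.
      apply: filterS cB => g Bg; apply: (AB (x, g)); split => //.
      exact: nbhs_singleton.
    have [g [Ug Vg]] := ab _ _ (ev a U Uax) (ev b V Vbx).
    by exists (g x).
  move=> x; apply: metric_hausdorff => U V Uax Vbx.
  have : nbhs x ((a : homeo X) @^-1` U `&` (b : homeo X) @^-1` V).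
    apply: filterI; first exact: homeo_continuous Uax.
    exact: homeo_continuous Vbx.
  rewrite nbhsE => -[W [oW Wx] WUV].
  have [y [Wy Oy]] := dO W (ex_intro _ x Wx) oW.
  have [Uy Vy] := WUV _ Wy; exists (a y); split => //.
  by rewrite /= fix_O.
Qed.

(** A member U of tau_k contains the translate h B of a ball around each of its
    points h; so it is enough that balls are sigma-neighborhoods of the
    identity, which holds if the sigma-neighborhoods of the identity converge
    continuously to it. *)
Lemma tau_k_coarser (sigma : set_system (homeo X)) : dense OX ->
  hausdorff_group_topology sigma -> tau_k C `<=` sigma.
Proof.
move=> dO [top [mulc invc haus]] U /tau_kP oU.
have hX : hausdorff_space X := @metric_hausdorff _ X.
pose S : topologicalType := topologized top.
pose one : S := (1%g : homeo X).
have near_touches W : open W -> W !=set0 ->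
    \forall h \near one, touches W (h : homeo X).
  by move=> oW W0; exact: (nbhs_touches hX dO mulc invc haus oW W0).
have one_cvg : bicvg_cts R (nbhs one) (id : S -> homeo X) 1%g.
  suff main x V : OX x -> nbhs x V -> \forall y \near x & h \near one,
      V ((h : homeo X) y) /\ V (((h : homeo X)^-1)%g y).
    by split=> x V Ox Vx; have := main x V Ox Vx; apply: filterS => p [].
  move=> Ox Vx.
  have [U1 [U2 [U3 [[oU1 U10] [U2x oU2] [oU3 U30] pin]]]] :=
    pinning hX Ox Vx.
  have U20 : U2 !=set0 by exists x; exact: nbhs_singleton.
  exists (U2, [set h : S | [/\ touches U1 (h : homeo X),
      touches U2 (h : homeo X) & touches U3 (h : homeo X)]]).
    split => //=; near=> h; split; near: h; exact: near_touches.
  move=> [y h] /= [U2y [h1 h2 h3]].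
  split; first exact: (pin h h1 h2 h3 y U2y).
  exact: (pin _ (touchesV h1) (touchesV h2) (touchesV h3) y U2y).
suff : open (U : set S) by [].
rewrite openE => h Uh; have [e /= e0 eU] := oU h Uh.
have hB := tau_k_ball_near (FF := nbhs_filter one) (tau_k_ball1 e0) one_cvg.
have hc : (fun k : S => (((h : homeo X)^-1)%g * (k : homeo X))%g : S) @ (h : S)
    --> one.
  rewrite (_ : one = ((h^-1)%g * h)%g); last by rewrite mulVg.
  have cst : (fun _ : S => (h^-1)%g : S) @ (h : S) --> ((h^-1)%g : S).
    exact: (@cvg_cst S _ S (nbhs (h : S)) _).
  have cid : (fun k : S => k) @ (h : S) --> (h : S) by exact: cvg_id.
  exact: (cvg_mulg mulc cst cid).
apply: (@filterS S (nbhs (h : S)) _ _ _ _ (hc _ hB)) => k /= /eU.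
by rewrite mulVKg.
Unshelve. all: by end_near.
Qed.

End TauK.

Theorem theorem7 (R : realType) (X : metricType R)
  (compactX : compact [set: X])
  (dense_OX : dense (one_manifold_part R X)) :
  minimum_hausdorff_group_topology (tau_k (~` one_manifold_part R X)).
Proof.
split; first exact: tau_k_hausdorff_group_topology.
by move=> sigma; exact: tau_k_coarser.
Qed.
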